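(* For each $k\ge0$ there is a finite $k$-graph $\Gamma$ whose topological realisation $X_\Gamma$ is homeomorphic to the $k$-sphere $S^k$.
   Context: A $k$-graph is a countable small category $\Lambda$ with a functor $d:\Lambda\to\mathbb{N}^k$ ($\mathbb{N}^0=\{0\}$) such that, writing $\Lambda^n=d^{-1}(n)$, composition is a bijection from $\{(\mu,\nu)\in\Lambda^m\times\Lambda^n:s(\mu)=r(\nu)\}$ onto $\Lambda^{m+n}$; finite means finitely many morphisms. For $k\ge1$: $\lambda(m,n)$ is the unique $\beta\in\Lambda^{n-m}$ with $\lambda=\alpha\beta\gamma$, $d(\alpha)=m$; $\lceil t\rceil,\lfloor t\rfloor$ are coordinatewise ceiling/floor; $[0,m]=\{t\in\mathbb{R}^k:0\le t\le m\}$; the topological realisation $X_\Lambda$ is the quotient of $\bigsqcup_\lambda\{\lambda\}\times[0,d(\lambda)]$ by $(\mu,s)\sim(\nu,t)\iff\mu(\lfloor s\rfloor,\lceil s\rceil)=\nu(\lfloor t\rfloor,\lceil t\rceil)$ and $s-\lfloor s\rfloor=t-\lfloor t\rfloor$. For $k=0$, $\Lambda=\Lambda^0$ and $X_\Lambda$ is the discrete space $\Lambda^0$ ($S^0$ is a two-point discrete space). *)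

(* Defs.v *)
From mathcomp Require Import ssreflect ssrbool ssrfun eqtype ssrnat seq fintype.
From Stdlib Require Import Reals.

Set Implicit Arguments.
Unset Strict Implicit.

Local Open Scope R_scope.

(* A small category with object type Obj and morphism type Mor; the   *)
(* composition [comp mu nu] (= mu nu, first nu then mu) is only        *)
(* meaningful when src mu = rng nu (axioms only constrain that case). *)
(* [deg] is the degree functor d : Lambda -> N^k, N^k = 'I_k -> nat.  *)
Record kgraph_data (k : nat) := KGraphData {
  Obj : Type;
  Mor : Type;
  src : Mor -> Obj;
  rng : Mor -> Obj;
  idm : Obj -> Mor;
  comp : Mor -> Mor -> Mor;
  deg : Mor -> 'I_k -> nat
}.

Definition is_category k (L : kgraph_data k) : Prop :=
  (forall v : Obj L, src (idm v) = v) /\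
  (forall v : Obj L, rng (idm v) = v) /\
  (forall mu nu : Mor L, src mu = rng nu -> src (comp mu nu) = src nu) /\
  (forall mu nu : Mor L, src mu = rng nu -> rng (comp mu nu) = rng mu) /\
  (forall mu : Mor L, comp mu (idm (src mu)) = mu) /\
  (forall mu : Mor L, comp (idm (rng mu)) mu = mu) /\
  (forall mu nu om : Mor L, src mu = rng nu -> src nu = rng om ->
     comp mu (comp nu om) = comp (comp mu nu) om).

Definition countable_type (T : Type) : Prop :=
  exists f : T -> nat, forall x y, f x = f y -> x = y.

Definition deg_functor k (L : kgraph_data k) : Prop :=
  (forall (v : Obj L) i, deg (idm v) i = 0%nat) /\
  (forall mu nu : Mor L, src mu = rng nu ->
     forall i, deg (comp mu nu) i = (deg mu i + deg nu i)%nat).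

Definition factorisation k (L : kgraph_data k) : Prop :=
  forall (l : Mor L) (m n : 'I_k -> nat),
    (forall i, deg l i = (m i + n i)%nat) ->
    exists mu nu,
      ((forall i, deg mu i = m i) /\ (forall i, deg nu i = n i) /\
       src mu = rng nu /\ comp mu nu = l) /\
      (forall mu' nu' : Mor L,
         (forall i, deg mu' i = m i) -> (forall i, deg nu' i = n i) ->
         src mu' = rng nu' -> comp mu' nu' = l -> mu' = mu /\ nu' = nu).

Definition is_kgraph k (L : kgraph_data k) : Prop :=
  countable_type (Mor L) /\ is_category L /\ deg_functor L /\ factorisation L.

Definition finite_kgraph k (L : kgraph_data k) : Prop :=
  exists s : list (Mor L), forall x, List.In x s.

Definition continuous {X Y : Type} (openX : (X -> Prop) -> Prop)
  (openY : (Y -> Prop) -> Prop) (f : X -> Y) : Prop :=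
  forall V, openY V -> openX (fun x => V (f x)).

Definition homeomorphic {X Y : Type} (openX : (X -> Prop) -> Prop)
  (openY : (Y -> Prop) -> Prop) : Prop :=
  exists (f : X -> Y) (g : Y -> X),
    (forall x, g (f x) = x) /\ (forall y, f (g y) = y) /\
    continuous openX openY f /\ continuous openY openX g.

Definition open_Rn (n : nat) (U : ('I_n -> R) -> Prop) : Prop :=
  forall x, U x -> exists eps, 0 < eps /\
    forall y, (forall i, Rabs (y i - x i) < eps) -> U y.

Definition quot (P : Type) (r : P -> P -> Prop) : Type :=
  { C : P -> Prop | exists p, forall q, C q <-> r p q }.

Definition cls (P : Type) (r : P -> P -> Prop) (p : P) : quot r :=
  exist (fun C => exists p0, forall q, C q <-> r p0 q) (r p)
        (ex_intro _ p (fun q => iff_refl (r p q))).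

Definition open_quot (P : Type) (openP : (P -> Prop) -> Prop)
  (r : P -> P -> Prop) (O : quot r -> Prop) : Prop :=
  openP (fun p => O (cls r p)).

Definition sumsq (n : nat) (x : 'I_n -> R) : R :=
  foldr Rplus 0 [seq (x i * x i) | i <- enum 'I_n].

Definition sphere (k : nat) : Type :=
  { x : 'I_k.+1 -> R | sumsq x = 1 }.

Definition open_sphere (k : nat) (V : sphere k -> Prop) : Prop :=
  exists U, open_Rn U /\ forall x : sphere k, V x <-> U (proj1_sig x).

Section Realisation.
Variables (k : nat) (L : kgraph_data k).

Definition cube (l : Mor L) : Type :=
  { t : 'I_k -> R | forall i, 0 <= t i <= INR (deg l i) }.

Definition rpoint : Type := { l : Mor L & cube l }.

Definition open_rpoint (W : rpoint -> Prop) : Prop :=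
  forall l, exists U, open_Rn U /\
    forall t : cube l, W (existT _ l t) <-> U (proj1_sig t).

(* coordinatewise floor / ceiling (as naturals; used on t >= 0) *)
Definition floor_vec (t : 'I_k -> R) (i : 'I_k) : nat := Z.to_nat (Int_part (t i)).
Definition ceil_vec (t : 'I_k -> R) (i : 'I_k) : nat :=
  Z.to_nat (- Int_part (- t i)).

Definition segment (l : Mor L) (m n : 'I_k -> nat) (b : Mor L) : Prop :=
  exists a c, src a = rng b /\ src b = rng c /\
    (forall i, deg a i = m i) /\ (forall i, deg b i = (n i - m i)%nat) /\
    l = comp a (comp b c).

Definition rrel (p q : rpoint) : Prop :=
  let mu := projT1 p in let s := proj1_sig (projT2 p) in
  let nu := projT1 q in let t := proj1_sig (projT2 q) in
  (exists b, segment mu (floor_vec s) (ceil_vec s) b /\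
             segment nu (floor_vec t) (ceil_vec t) b) /\
  (forall i, frac_part (s i) = frac_part (t i)).

Definition realisation : Type := quot rrel.
Definition open_realisation : (realisation -> Prop) -> Prop :=
  open_quot open_rpoint (r:=rrel).

End Realisation.

(* Main.v *)
(** Let E be the 1-graph with two edges that share their source and have
    distinct ranges; its realisation is the interval [-1,1], and E^k realises
    the cube [-1,1]^k.  Glue two copies of E^k along the cells that lie in the
    boundary of the cube.  Unique factorisation survives the gluing: on a
    composable pair the source of the left factor lies in the boundary exactly
    when the left factor does, so the composite can take its sheet from the
    right factor.  The realisation is two k-cubes glued along their boundaries,
    which is identified with {(z,y) : |z| + max_i |y_i| = 1} by
    (y, sign) |-> (sign * (1 - max_i |y_i|), y), and then radially with S^k. *)

Require Import Defs.
From HB Require Import structures.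
From mathcomp Require Import all_boot.
From Stdlib Require Import Reals Lra.
From Stdlib Require Import FunctionalExtensionality PropExtensionality.
From Stdlib Require Import ProofIrrelevance ClassicalEpsilon.
From Coquelicot Require Import Coquelicot.

Set Implicit Arguments.
Unset Strict Implicit.
Unset Printing Implicit Defensive.

Local Open Scope R_scope.

(** * The 1-graph E and its factorisations *)

(* The morphisms of E: [Bd s] is the vertex at the end s of the interval, [Mid]
   the central vertex, and [Edge s] the edge from [Mid] to [Bd s].  A vertex is
   encoded by [Some s] for an end and [None] for the centre. *)
Inductive arrow := Bd of bool | Mid | Edge of bool.

Definition arrow_code (x : arrow) : bool + option bool :=
  match x with Bd s => inl s | Mid => inr None | Edge s => inr (Some s) end.
Definition arrow_decode (u : bool + option bool) : arrow :=
  match u with inl s => Bd s | inr None => Mid | inr (Some s) => Edge s end.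
Lemma arrow_codeK : cancel arrow_code arrow_decode.
Proof. by case. Qed.
HB.instance Definition _ := Finite.copy arrow (can_type arrow_codeK).

Definition src1 (x : arrow) : option bool := if x is Bd s then Some s else None.
Definition rng1 (x : arrow) : option bool :=
  match x with Bd s => Some s | Mid => None | Edge s => Some s end.
Definition id1 (v : option bool) : arrow := if v is Some s then Bd s else Mid.
(** An edge has source [Mid], so its only right partner is the identity [Mid]; any other [x] is
    itself an identity, and the composite is [y]. *)
Definition comp1 (x y : arrow) : arrow := if x is Edge _ then x else y.
Definition deg1 (x : arrow) : nat := match x with Edge _ => 1%nat | _ => 0%nat end.
(** For [m <= deg1 x], [head1 x m] and [tail1 x m] are the two factors of [x], the left one having
    degree [m]. *)
Definition head1 (x : arrow) (m : nat) : arrow :=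
  if m is 0%nat then id1 (rng1 x) else x.
Definition tail1 (x : arrow) (m : nat) : arrow :=
  if m is 0%nat then x else id1 (src1 x).
(** An edge stands for an open cell, hence lies off the boundary even though its range is an end of
    the interval. *)
Definition bd1 (x : arrow) : bool := if x is Bd _ then true else false.

(** * Doubling a power along its boundary *)

Section Double.
Variables (k : nat) (T : finType) (bd : pred T).

(* A cell together with the sheet it lies on; cells in the boundary are shared
   by the two sheets, and carry the sheet [false] by convention. *)
Definition doubled : Type :=
  {p : {ffun 'I_k -> T} * bool | [exists i, bd (p.1 i)] ==> ~~ p.2}.

Definition crd (x : doubled) (i : 'I_k) : T := (val x).1 i.
Definition sheet (x : doubled) : bool := (val x).2.

Lemma glue_subproof (c : 'I_k -> T) (e : bool) :
  [exists i, bd ([ffun j => c j] i)] ==>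
    ~~ (e && ~~ [exists i, bd ([ffun j => c j] i)]).
Proof. by apply/implyP => ->; rewrite andbF. Qed.

(** Resetting the bit on boundary cells performs the gluing: both choices of [e] then name the same
    cell. *)
Definition glue (c : 'I_k -> T) (e : bool) : doubled :=
  exist _ ([ffun j => c j], e && ~~ [exists i, bd ([ffun j => c j] i)])
    (glue_subproof c e).

Lemma crd_glue c e i : crd (glue c e) i = c i.
Proof. by rewrite /crd ffunE. Qed.

Lemma sheet_glue c e : (forall i, ~~ bd (c i)) -> sheet (glue c e) = e.
Proof.
move=> nc; rewrite /sheet /=; case: existsP => [[i]|_]; last by rewrite andbT.
by rewrite ffunE (negbTE (nc i)).
Qed.

(** A boundary cell admits only the bit [false], so sheets have to be compared only off the
    boundary. *)
Lemma doubled_eq (x y : doubled) : (forall i, crd x i = crd y i) ->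
  ((forall i, ~~ bd (crd x i)) -> sheet x = sheet y) -> x = y.
Proof.
move=> Exy Es; have E1 : (val x).1 = (val y).1 by apply/ffunP.
apply: val_inj; rewrite [LHS]surjective_pairing [RHS]surjective_pairing E1.
congr pair; case nx: [exists i, bd ((val x).1 i)].
  have := valP x; have := valP y; rewrite -E1 nx /=.
  by move=> /negbTE -> /negbTE ->.
by apply: Es => i; apply: contraFN nx => bi; apply/existsP; exists i.
Qed.

End Double.

(** * The doubled cube as a finite k-graph *)

Section Graph.
Variable k : nat.

Let mor := doubled k bd1.
Let obj := doubled k (@isSome bool).

Definition dsrc (x : mor) : obj := glue _ (fun i => src1 (crd x i)) (sheet x).
Definition drng (x : mor) : obj := glue _ (fun i => rng1 (crd x i)) (sheet x).
Definition did (v : obj) : mor := glue _ (fun i => id1 (crd v i)) (sheet v).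
Definition dcomp (x y : mor) : mor :=
  glue _ (fun i => comp1 (crd x i) (crd y i)) (sheet y).
Definition ddeg (x : mor) (i : 'I_k) : nat := deg1 (crd x i).

Definition doubled_cube : kgraph_data k := KGraphData dsrc drng did dcomp ddeg.

Definition dhead (x : mor) (m : 'I_k -> nat) : mor :=
  glue _ (fun i => head1 (crd x i) (m i)) (sheet x).
Definition dtail (x : mor) (m : 'I_k -> nat) : mor :=
  glue _ (fun i => tail1 (crd x i) (m i)) (sheet x).

Lemma composable_crd (x y : mor) :
  dsrc x = drng y -> forall i, src1 (crd x i) = rng1 (crd y i).
Proof. by move=> /(congr1 (fun z => crd z _)) E i; have := E i; rewrite !crd_glue. Qed.

(** If [x] is off the boundary, so is its source, and the common vertex [dsrc x = drng y] still
    remembers both sheets. *)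
Lemma composable_sheet (x y : mor) : dsrc x = drng y ->
  (forall i, ~~ bd1 (crd x i)) -> sheet x = sheet y.
Proof.
move=> E nx; have := congr1 (@sheet _ _ _) E; have Ec := composable_crd E.
rewrite !sheet_glue // => i; first by rewrite -Ec; have := nx i; case: (crd x i).
by have := nx i; case: (crd x i).
Qed.

Lemma doubled_cube_category : is_category doubled_cube.
Proof.
do !split => //=.
- move=> v; apply: doubled_eq => [i|nv].
    by rewrite !crd_glue; case: (crd v i).
  rewrite !sheet_glue // => i; have := nv i; rewrite !crd_glue //.
  by case: (crd v i).
- move=> v; apply: doubled_eq => [i|nv].
    by rewrite !crd_glue; case: (crd v i).
  rewrite !sheet_glue // => i; have := nv i; rewrite !crd_glue //.
  by case: (crd v i).
- move=> x y E; have Ec := composable_crd E; apply: doubled_eq => [i|nv].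
    by rewrite !crd_glue; have := Ec i; case: (crd x i); case: (crd y i).
  by rewrite !sheet_glue // => i; have := nv i; rewrite !crd_glue;
    have := Ec i; case: (crd x i); case: (crd y i).
- move=> x y E; have Ec := composable_crd E; apply: doubled_eq => [i|nv].
    by rewrite !crd_glue; have := Ec i; case: (crd x i); case: (crd y i) => //= ? [->].
  (* Ends and edges both have an end as range, so a range off the boundary forces [Mid] in every
     coordinate of [x], and then of [y]; the sheets of [x] and [y] therefore agree. *)
  have nx i : crd x i = Mid.
    by have := nv i; rewrite !crd_glue; have := Ec i; case: (crd x i); case: (crd y i).
  rewrite !sheet_glue ?(composable_sheet E) // => i; rewrite ?crd_glue nx //.
    by have := Ec i; rewrite nx; case: (crd y i).
  by have := Ec i; rewrite nx; case: (crd y i).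
- move=> x; apply: doubled_eq => [i|nv].
    by rewrite !crd_glue; case: (crd x i).
  by rewrite !sheet_glue // => i; have := nv i; rewrite !crd_glue //; case: (crd x i).
- move=> x; apply: doubled_eq => [i|nv].
    by rewrite !crd_glue; case: (crd x i).
  by rewrite !sheet_glue // => i; have := nv i; rewrite !crd_glue //; case: (crd x i).
- move=> x y z /composable_crd Exy /composable_crd Eyz.
  apply: doubled_eq => [i|nv].
    by rewrite !crd_glue; case: (crd x i).
  rewrite !sheet_glue // => i; have := nv i; rewrite !crd_glue //.
    by have := Exy i; case: (crd x i); case: (crd y i).
  by have := Exy i; have := Eyz i; case: (crd x i); case: (crd y i); case: (crd z i).
Qed.

Lemma doubled_cube_deg_functor : deg_functor doubled_cube.
Proof.
split=> [v i|x y /composable_crd Exy i] /=; rewrite /ddeg !crd_glue.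
  by case: (crd v i).
by have := Exy i; case: (crd x i); case: (crd y i).
Qed.

(** Existence of factorisations is checked in E coordinate by coordinate; both factors inherit the
    sheet of [l], so the sheets match wherever they count. *)
Lemma head_tail (l : mor) (m : 'I_k -> nat) : (forall i, m i <= ddeg l i)%nat ->
  [/\ forall i, ddeg (dhead l m) i = m i,
      forall i, ddeg (dtail l m) i = (ddeg l i - m i)%nat,
      dsrc (dhead l m) = drng (dtail l m) &
      dcomp (dhead l m) (dtail l m) = l].
Proof.
rewrite /ddeg => le_m.
have H i : [/\ deg1 (head1 (crd l i) (m i)) = m i,
    deg1 (tail1 (crd l i) (m i)) = (deg1 (crd l i) - m i)%nat,
    src1 (head1 (crd l i) (m i)) = rng1 (tail1 (crd l i) (m i)) &
    comp1 (head1 (crd l i) (m i)) (tail1 (crd l i) (m i)) = crd l i].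
  by have := le_m i; case: (crd l i) => [s||s]; case: (m i) => [|[|n]].
split.
- by move=> i; rewrite crd_glue; case: (H i).
- by move=> i; rewrite crd_glue; case: (H i).
- apply: doubled_eq => [i|nv]; first by rewrite !crd_glue; case: (H i).
  rewrite !sheet_glue // => i; have := nv i; rewrite !crd_glue //;
  have := le_m i; by case: (crd l i) => [s||s]; case: (m i) => [|[|n]].
- apply: doubled_eq => [i|nv]; first by rewrite !crd_glue; case: (H i).
  rewrite !sheet_glue // => i; have := nv i; rewrite !crd_glue //;
  have := le_m i; by case: (crd l i) => [s||s]; case: (m i) => [|[|n]].
Qed.

Lemma doubled_cube_factorisation : factorisation doubled_cube.
Proof.
move=> l m n; rewrite /= => Dl.
have le_m i : (m i <= ddeg l i)%nat by rewrite Dl leq_addr.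
have [Dh Dt Eht El] := head_tail le_m.
exists (dhead l m), (dtail l m); split.
  by split=> //; split=> // i; rewrite Dt Dl addKn.
move=> x y; rewrite /ddeg => Dx Dy E Exy; have Ec := composable_crd E.
have H i : crd x i = head1 (crd l i) (m i) /\ crd y i = tail1 (crd l i) (m i).
  rewrite -Exy -Dx crd_glue; have := Ec i.
  by case: (crd x i) => [s||s]; case: (crd y i) => [s'||s'] //= [->].
have nl i : bd1 (crd l i) -> bd1 (crd y i).
  rewrite -Exy crd_glue; have := Ec i.
  by case: (crd x i) => [s||s]; case: (crd y i) => [s'||s'].
(* A composite takes its sheet from [y] and is off the boundary when [y] is, so the sheet of [y] can
   be read off [l]. The sheet of [x] then follows from composability. *)
have Esy : (forall i, ~~ bd1 (crd y i)) -> sheet y = sheet l.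
  move=> ny; rewrite -Exy sheet_glue // => i; have := ny i; have := Ec i.
  by case: (crd x i) => [s||s]; case: (crd y i) => [s'||s'].
split; apply: doubled_eq => [i|nv].
- by rewrite crd_glue; case: (H i).
- rewrite (composable_sheet E) // Esy => [|i].
    by rewrite sheet_glue // => i; have := nv i; case: (H i) => ->.
  by have := Ec i; have := nv i; case: (crd x i); case: (crd y i).
- by rewrite crd_glue; case: (H i).
- by rewrite Esy // sheet_glue // => i; have := nv i; case: (H i) => _ ->.
Qed.

Lemma doubled_cube_kgraph : is_kgraph doubled_cube.
Proof.
split; last by split; [exact: doubled_cube_category | split;
  [exact: doubled_cube_deg_functor | exact: doubled_cube_factorisation]].
by exists (@pickle mor); exact: (pcan_inj pickleK).
Qed.

Lemma doubled_cube_finite : finite_kgraph doubled_cube.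
Proof.
exists (enum {: mor}) => x.
have : x \in enum {: mor} by rewrite mem_enum.
by elim: (enum {: mor}) => //= y s IH; rewrite inE => /predU1P[->|/IH]; [left|right].
Qed.

End Graph.

(** * Uniqueness of segments in a k-graph *)

(** Unique factorisation is applied twice: cutting [l] at degree [m] determines the product [b c],
    and cutting that product determines [b]. *)
Lemma segment_unique k (L : kgraph_data k) (l b b' : Mor L) (m n : 'I_k -> nat) :
  is_kgraph L -> segment l m n b -> segment l m n b' -> b = b'.
Proof.
move=> [_ [[_ [_ [Csrc [Crng _]]]] [[_ Cdeg] fact]]].
move=> [a [c [ab [bc [Da [Db El]]]]]] [a' [c' [ab' [bc' [Da' [Db' El']]]]]].
have abc : src a = rng (Defs.comp b c) by rewrite Crng.
have abc' : src a' = rng (Defs.comp b' c') by rewrite Crng.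
have Dl i : deg l i = (m i + ((n i - m i) + deg c i))%nat.
  by rewrite El !Cdeg // Da Db.
have Dl' i : deg l i = (m i + ((n i - m i) + deg c' i))%nat.
  by rewrite El' !Cdeg // Da' Db'.
(* The total degree of [l] fixes the degree of the last factor, so both decompositions cut [l] at
   the same degrees. *)
have Dc i : deg c' i = deg c i.
  by apply/eqP; rewrite -(eqn_add2l (m i + (n i - m i))) -!addnA -Dl -Dl'.
have [x [y [_ Uxy]]] := fact l m (fun i => (n i - m i) + deg c i)%nat Dl.
have Ebc : Defs.comp b c = Defs.comp b' c'.
  have [] := Uxy a (Defs.comp b c) => //; first by move=> i; rewrite Cdeg // Db.
  have [] := Uxy a' (Defs.comp b' c') => //; first by move=> i; rewrite Cdeg // Db' Dc.
  by move=> _ -> _ ->.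
have [u [v [_ Uuv]]] := fact (Defs.comp b c) (fun i => n i - m i)%nat (deg c)
  (fun i => etrans (Cdeg b c bc i) (congr1 (fun d => d + deg c i)%nat (Db i))).
have [] := Uuv b c => // -> _.
by have [] := Uuv b' c' => //.
Qed.

(** * Open sets and continuity in Euclidean space *)

Notation vec n := (fct_UniformSpace 'I_n R_UniformSpace).

(** The uniform structure on [vec n] has exactly the coordinatewise balls of [open_Rn], which gives
    access to continuity by filters. *)
Lemma open_Rn_locally n (U : ('I_n -> R) -> Prop) :
  open_Rn U <-> forall x : vec n, U x -> locally x U.
Proof.
split=> oU x Ux; have := oU x Ux.
  by move=> [e [e0 He]]; exists (mkposreal e e0) => y; exact: He.
by move=> [e He]; exists e; split; [exact: cond_pos | move=> y; exact: He].
Qed.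

Lemma locally_all (I : finType) (T : UniformSpace) (x : T) (P : I -> T -> Prop) :
  (forall i, locally x (P i)) -> locally x (fun y => forall i, P i y).
Proof.
move=> HP; suff: locally x (fun y => forall i, i \in enum I -> P i y).
  by apply: filter_imp => y Hy i; apply: Hy; rewrite mem_enum.
elim: (enum I) => [|j s IH]; first exact: filter_forall.
apply: filter_imp (filter_and _ _ (HP j) IH) => y [Pj Ps] i.
by rewrite inE => /predU1P[->|/Ps].
Qed.

Lemma continuous_vec (T : UniformSpace) m (F : T -> vec m) (x : T) :
  (forall j, continuous (fun y => F y j) x) -> continuous F x.
Proof.
move=> cF P [e He]; rewrite /filtermap.
have : locally x (fun y => forall j, ball (F x j) e (F y j)).
  by apply: locally_all => j; apply: (cF j); exact: locally_ball.
by apply: filter_imp => y Hy; apply: He.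
Qed.

Lemma continuous_coord n (i : 'I_n) (x : vec n) :
  continuous (fun y : vec n => y i : R_UniformSpace) x.
Proof. by move=> P [e He]; exists e => y Hy; apply: He; apply: Hy. Qed.

Lemma continuous_Rabs_fun (T : UniformSpace) (f : T -> R_UniformSpace) (x : T) :
  continuous f x -> continuous (fun y => Rabs (f y) : R_UniformSpace) x.
Proof. by move=> cf; exact: (@continuous_comp _ R_UniformSpace R_UniformSpace f Rabs x cf (continuous_Rabs _)). Qed.

Definition sub_open n (D : ('I_n -> R) -> Prop) (V : {x | D x} -> Prop) : Prop :=
  exists U, open_Rn U /\ forall x, V x <-> U (proj1_sig x).

Lemma sub_continuous n m (D : ('I_n -> R) -> Prop) (D' : ('I_m -> R) -> Prop)
    (F : vec n -> vec m) (f : {x | D x} -> {x | D' x}) :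
  (forall x, proj1_sig (f x) = F (proj1_sig x)) ->
  (forall x, D x -> continuous F x) ->
  Defs.continuous (@sub_open n D) (@sub_open m D') f.
Proof.
move=> fF cF V [U [/open_Rn_locally oU VU]].
(* This is the interior of the preimage of [U]: open in the whole space, although [F] is continuous
   only at points of [D]. *)
exists (fun x : vec n => locally x (fun y => U (F y))); split.
  by apply/open_Rn_locally => x; exact: locally_locally.
move=> x; rewrite VU fF; split; last exact: locally_singleton.
by move=> Ux; apply: (cF _ (proj2_sig x)); exact: oU.
Qed.

Lemma homeomorphic_trans (X Y Z : Type) oX oY oZ :
  @homeomorphic X Y oX oY -> @homeomorphic Y Z oY oZ -> homeomorphic oX oZ.
Proof.
move=> [f [g [gf [fg [cf cg]]]]] [h [l [lh [hl [ch cl]]]]].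
exists (fun x => h (f x)), (fun z => g (l z)); do !split.
- by move=> x; rewrite lh.
- by move=> z; rewrite fg.
- by move=> V /ch /cf.
- by move=> V /cg /cl.
Qed.

Lemma sub_eq n (D : ('I_n -> R) -> Prop) (x y : {x | D x}) :
  (forall i, proj1_sig x i = proj1_sig y i) -> x = y.
Proof.
case: x y => x Dx [y Dy] /= /functional_extensionality E; subst y.
by congr exist; exact: proof_irrelevance.
Qed.

(** * Radial projection between unit level sets *)

Section Radial.
Variables (n : nat) (D1 D2 : ('I_n -> R) -> Prop) (N1 N2 : vec n -> R_UniformSpace).
Hypothesis D1E : forall x, D1 x <-> N1 x = 1.
Hypothesis D2E : forall x, D2 x <-> N2 x = 1.
Hypothesis N1_cont : forall x, continuous N1 x.
Hypothesis N2_cont : forall x, continuous N2 x.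
Hypothesis N1_homog : forall a x, 0 < a -> N1 (fun i => a * x i) = a * N1 x.
Hypothesis N2_homog : forall a x, 0 < a -> N2 (fun i => a * x i) = a * N2 x.
Hypothesis N1_gt0 : forall x, D2 x -> 0 < N1 x.
Hypothesis N2_gt0 : forall x, D1 x -> 0 < N2 x.

Lemma radial_continuous (N : vec n -> R_UniformSpace) (x : vec n) :
  (forall y, continuous N y) -> N x <> 0 ->
  continuous (fun y : vec n => (fun i => / N y * y i) : vec n) x.
Proof.
move=> cN Nx; apply: continuous_vec => i.
apply: (@continuous_mult _ R_AbsRing); last exact: continuous_coord.
exact: continuous_comp (cN x) (continuous_Rinv _ Nx).
Qed.

(** Scaling [x] by [/ N2 x] is inverse to scaling by [/ N1 x]: if [N1 x = 1], homogeneity gives the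
    scaled point [N1]-value [/ N2 x], and dividing by it returns [x]. *)
Lemma radial_homeomorphic : homeomorphic (@sub_open n D1) (@sub_open n D2).
Proof.
have H12 x : D1 x -> D2 (fun i => / N2 x * x i).
  move=> Dx; have N0 := N2_gt0 Dx; apply/D2E.
  by rewrite N2_homog ?Rinv_l //; [lra | exact: Rinv_0_lt_compat].
have H21 x : D2 x -> D1 (fun i => / N1 x * x i).
  move=> Dx; have N0 := N1_gt0 Dx; apply/D1E.
  by rewrite N1_homog ?Rinv_l //; [lra | exact: Rinv_0_lt_compat].
exists (fun x => exist D2 _ (H12 _ (proj2_sig x))).
exists (fun x => exist D1 _ (H21 _ (proj2_sig x))); split; [|split; [|split]].
- move=> [x Dx]; apply: sub_eq => i /=; have N0 := N2_gt0 Dx.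
  have -> := N1_homog x (Rinv_0_lt_compat _ N0).
  by have /D1E -> := Dx; field; lra.
- move=> [x Dx]; apply: sub_eq => i /=; have N0 := N1_gt0 Dx.
  have -> := N2_homog x (Rinv_0_lt_compat _ N0).
  by have /D2E -> := Dx; field; lra.
- apply: (@sub_continuous _ _ _ _ (fun x => fun i => / N2 x * x i)) => // x Dx.
  by apply: radial_continuous => //; have := N2_gt0 Dx; lra.
- apply: (@sub_continuous _ _ _ _ (fun x => fun i => / N1 x * x i)) => // x Dx.
  by apply: radial_continuous => //; have := N1_gt0 Dx; lra.
Qed.

End Radial.

(** * The maximum norm, the gauge of the double cone, and the Euclidean norm *)

Definition maxabs n (y : 'I_n -> R) : R :=
  foldr Rmax 0 [seq Rabs (y i) | i <- enum 'I_n].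

Lemma le_maxabs n (y : 'I_n -> R) i : Rabs (y i) <= maxabs y.
Proof.
rewrite /maxabs; have : i \in enum 'I_n by rewrite mem_enum.
elim: (enum 'I_n) => //= j s IH; rewrite inE => /predU1P[->|/IH H].
  exact: Rmax_l.
exact: Rle_trans H (Rmax_r _ _).
Qed.

Lemma maxabs_ge0 n (y : 'I_n -> R) : 0 <= maxabs y.
Proof.
rewrite /maxabs; elim: (enum 'I_n) => /= [|j s IH]; first lra.
exact: Rle_trans IH (Rmax_r _ _).
Qed.

Lemma maxabs_le n (y : 'I_n -> R) a :
  0 <= a -> (forall i, Rabs (y i) <= a) -> maxabs y <= a.
Proof.
by move=> a0 Ha; rewrite /maxabs; elim: (enum 'I_n) => //= j s IH; apply: Rmax_lub.
Qed.

Lemma maxabs_lt n (y : 'I_n -> R) a :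
  0 < a -> (forall i, Rabs (y i) < a) -> maxabs y < a.
Proof.
move=> a0 Ha; rewrite /maxabs; elim: (enum 'I_n) => //= j s IH.
exact: Rmax_lub_lt.
Qed.

Lemma maxabs_homog n (y : 'I_n -> R) a :
  0 < a -> maxabs (fun i => a * y i) = a * maxabs y.
Proof.
move=> a0; rewrite /maxabs; elim: (enum 'I_n) => /= [|j s ->]; first lra.
by rewrite -RmaxRmult; [rewrite Rabs_mult (Rabs_pos_eq a) //; lra | lra].
Qed.

Lemma maxabs_continuous n (y : vec n) :
  continuous (fun x : vec n => maxabs x : R_UniformSpace) y.
Proof.
rewrite /maxabs; elim: (enum 'I_n) => /= [|j s IH]; first exact: continuous_const.
have RmaxE a b : Rmax a b = / 2 * (a + b + Rabs (a - b)).
  by rewrite /Rmax; case: Rle_dec => H; [rewrite Rabs_left1 | rewrite Rabs_pos_eq]; lra.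
have cj : continuous (fun x : vec n => Rabs (x j) : R_UniformSpace) y.
  by apply: continuous_Rabs_fun; exact: continuous_coord.
apply: continuous_ext => [x|]; first by rewrite RmaxE.
apply: (@continuous_mult _ R_AbsRing); first exact: continuous_const.
apply: (@continuous_plus _ R_AbsRing R_NormedModule).
  exact: (@continuous_plus _ R_AbsRing R_NormedModule).
apply: continuous_Rabs_fun.
exact: (@continuous_minus _ R_AbsRing R_NormedModule).
Qed.

(** The norm whose unit sphere is the double cone over the boundary of the cube, with coordinate 0
    as axis. For [n = 0] the maximum is 0 and the unit sphere is the pair of points 1 and -1. *)
Definition gauge n (x : 'I_n.+1 -> R) : R :=
  Rabs (x ord0) + maxabs (fun i : 'I_n => x (lift ord0 i)).

Lemma gauge_homog n (x : 'I_n.+1 -> R) a :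
  0 < a -> gauge (fun i => a * x i) = a * gauge x.
Proof.
move=> a0; rewrite /gauge (maxabs_homog (fun i : 'I_n => x (lift ord0 i)) a0).
by rewrite Rabs_mult (Rabs_pos_eq a); lra.
Qed.

Lemma gauge_continuous n (x : vec n.+1) :
  continuous (fun y : vec n.+1 => gauge y : R_UniformSpace) x.
Proof.
apply: (@continuous_plus _ R_AbsRing R_NormedModule).
  by apply: continuous_Rabs_fun; exact: continuous_coord.
apply: (continuous_comp (fun y : vec n.+1 => (fun i => y (lift ord0 i)) : vec n)
  (fun z => maxabs z)); last exact: maxabs_continuous.
by apply: continuous_vec => j; exact: continuous_coord.
Qed.

Lemma gauge_gt0 n (x : 'I_n.+1 -> R) j : x j <> 0 -> 0 < gauge x.
Proof.
move=> /Rabs_pos_lt xj; have M0 := maxabs_ge0 (fun i : 'I_n => x (lift ord0 i)).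
have x0 := Rabs_pos (x ord0); rewrite /gauge.
case: (unliftP ord0 j) xj => [i ->|->] xj; last lra.
by have /= := le_maxabs (fun i : 'I_n => x (lift ord0 i)) i; lra.
Qed.

Lemma sumsq_ge0 n (x : 'I_n -> R) : 0 <= sumsq x.
Proof.
rewrite /sumsq; elim: (enum 'I_n) => /= [|j s IH]; first lra.
by have := Rle_0_sqr (x j); rewrite /Rsqr; lra.
Qed.

Lemma sumsq_gt0 n (x : 'I_n -> R) j : x j <> 0 -> 0 < sumsq x.
Proof.
move=> xj; suff: x j * x j <= sumsq x by have := Rsqr_pos_lt _ xj; rewrite /Rsqr; lra.
rewrite /sumsq; have : j \in enum 'I_n by rewrite mem_enum.
elim: (enum 'I_n) => //= i s IH; have := Rle_0_sqr (x i); rewrite /Rsqr => xi.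
rewrite inE => /predU1P[->|/IH]; last lra.
suff: 0 <= foldr Rplus 0 [seq x i * x i | i <- s] by lra.
elim: (s) => /= [|l t IHt]; first lra.
by have := Rle_0_sqr (x l); rewrite /Rsqr; lra.
Qed.

Lemma sumsq_homog n (x : 'I_n -> R) a :
  sumsq (fun i => a * x i) = (a * a) * sumsq x.
Proof. by rewrite /sumsq; elim: (enum 'I_n) => /= [|j s ->]; lra. Qed.

Lemma sumsq_continuous n (x : vec n) :
  continuous (fun y : vec n => sumsq y : R_UniformSpace) x.
Proof.
rewrite /sumsq; elim: (enum 'I_n) => /= [|j s IH]; first exact: continuous_const.
apply: (@continuous_plus _ R_AbsRing R_NormedModule) IH.
by apply: (@continuous_mult _ R_AbsRing); exact: continuous_coord.
Qed.

(** The zero vector is its own double, so homogeneity with factor 2 would turn the value 1 into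
    2. *)
Lemma nonzero_coord n (N : ('I_n -> R) -> R) (x : 'I_n -> R) :
  (forall y a, 0 < a -> N (fun i => a * y i) = a * N y) -> N x = 1 ->
  exists j, x j <> 0.
Proof.
move=> homog Nx; case: (excluded_middle_informative (exists j, x j <> 0)) => // H.
have x0 j : x j = 0.
  by case: (Req_dec (x j) 0) => // xj; case: H; exists j.
have := homog x 2 ltac:(lra); rewrite (_ : (fun i => 2 * x i) = x) ?Nx; first lra.
by apply: functional_extensionality => j; rewrite x0; lra.
Qed.

Lemma norm_homog n (x : 'I_n -> R) a :
  0 < a -> sqrt (sumsq (fun i => a * x i)) = a * sqrt (sumsq x).
Proof.
by move=> a0; rewrite sumsq_homog sqrt_mult ?sqrt_square; try nra; exact: sumsq_ge0.
Qed.

Lemma gauge_sphere_homeomorphic k :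
  homeomorphic (@sub_open k.+1 (fun x => gauge x = 1)) (@open_sphere k).
Proof.
(* The radial argument needs homogeneity of degree one; [sumsq] has degree two, so its square root
   is used. *)
have normE (x : 'I_k.+1 -> R) : sumsq x = 1 <-> sqrt (sumsq x) = 1.
  split=> [->|E]; first exact: sqrt_1.
  by rewrite -(sqrt_sqrt _ (sumsq_ge0 x)) E; lra.
apply: (@radial_homeomorphic _ _ (fun x => sumsq x = 1) (fun x => gauge x)
  (fun x => sqrt (sumsq x))) => //.
- exact: gauge_continuous.
- by move=> x; apply: continuous_comp (continuous_sqrt _); exact: sumsq_continuous.
- by move=> a x; exact: gauge_homog.
- by move=> a x; exact: norm_homog.
- by move=> x /normE /(nonzero_coord (@norm_homog _))[j /gauge_gt0].
- move=> x /(nonzero_coord (@gauge_homog _))[j /sumsq_gt0].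
  exact: sqrt_lt_R0.
Qed.

(** * Homeomorphisms out of a quotient *)

(** The classes of [r] are the fibres of [f], and [g] picks a point in each fibre. Open sets of the
    quotient are saturated open sets upstairs, so [g] is tested on these alone; this admits a
    section that jumps between cells. *)
Lemma quot_homeomorphic (P Y : Type) (openP : (P -> Prop) -> Prop)
    (openY : (Y -> Prop) -> Prop) (r : P -> P -> Prop) (f : P -> Y) (g : Y -> P) :
  (forall p q, r p q <-> f p = f q) -> (forall y, f (g y) = y) ->
  Defs.continuous openP openY f ->
  (forall O, (forall p q, f p = f q -> O p -> O q) -> openP O ->
     openY (fun y => O (g y))) ->
  homeomorphic (@open_quot P openP r) openY.
Proof.
move=> rf fg cf cg.
have cls_eq p q : r p q -> cls r p = cls r q.
  move=> rpq; have E : r p = r q.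
    apply: functional_extensionality => z; apply: propositional_extensionality.
    by rewrite !rf; have /rf -> := rpq.
  rewrite /cls; move: (ex_intro _ p _) (ex_intro _ q _); rewrite /= E => H1 H2.
  by congr exist; exact: proof_irrelevance.
have rep (C : quot r) : {p | cls r p = C}.
  apply: constructive_indefinite_description; case: C => C [p HC]; exists p.
  have E : C = r p.
    apply: functional_extensionality => z; exact: propositional_extensionality.
  by subst C; rewrite /cls; congr exist; exact: proof_irrelevance.
have f_rep p : f (proj1_sig (rep (cls r p))) = f p.
  case: (rep _) => q /= E; apply/rf.
  by have := congr1 (fun C => proj1_sig C p) E => /= ->; apply/rf.
exists (fun C => f (proj1_sig (rep C))), (fun y => cls r (g y)); split; [|split; [|split]].
- move=> C; rewrite -[RHS](proj2_sig (rep C)); apply: cls_eq; apply/rf.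
  by rewrite fg.
- by move=> y; rewrite f_rep fg.
- move=> V /cf; rewrite /open_quot.
  have -> // : (fun p => V (f (proj1_sig (rep (cls r p))))) = (fun p => V (f p)).
  by apply: functional_extensionality => p; rewrite f_rep.
- move=> O oO; apply: (cg (fun p => O (cls r p))) => // p q /rf/cls_eq -> //.
Qed.

(** * The interval as the realisation of E *)

Definition sgn (s : bool) : R := if s then -1 else 1.

(* The range [Bd s] of [Edge s] sits at parameter 0, its source [Mid] at 1. *)
Definition pos1 (x : arrow) (t : R) : R :=
  match x with Bd s => sgn s | Mid => 0 | Edge s => sgn s * (1 - t) end.

(** The segment of [x] from floor to ceiling of [t], for one coordinate; [- Int_part (- t)] is the
    ceiling. *)
Definition cell1 (x : arrow) (t : R) : arrow :=
  head1 (tail1 x (Z.to_nat (Int_part t)))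
    (Z.to_nat (- Int_part (- t)) - Z.to_nat (Int_part t))%nat.

(** The normal form: [t] lies in the open cell of [x]. *)
Definition reduced1 (x : arrow) (t : R) : Prop :=
  if x is Edge _ then 0 < t < 1 else t = 0.

Lemma unit_floor_ceil t : 0 <= t <= 1 ->
  [/\ t = 0, Int_part t = 0%Z, Int_part (- t) = 0%Z & frac_part t = 0] \/
  [/\ t = 1, Int_part t = 1%Z, Int_part (- t) = (-1)%Z & frac_part t = 0] \/
  [/\ 0 < t < 1, Int_part t = 0%Z, Int_part (- t) = (-1)%Z & frac_part t = t].
Proof.
move=> [t0 t1].
have IP z : t - 1 < IZR z <= t -> Int_part t = z by move/Int_part_spec.
have IN z : - t - 1 < IZR z <= - t -> Int_part (- t) = z by move/Int_part_spec.
case: (Rle_lt_or_eq_dec _ _ t0) => [t0'|E].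
  case: (Rle_lt_or_eq_dec _ _ t1) => [t1'|E].
    right; right; have E : Int_part t = 0%Z by apply: IP; lra.
    by split=> //; [apply: IN; lra | rewrite /frac_part E; lra].
  right; left; have E1 : Int_part t = 1%Z by apply: IP; lra.
  by split=> //; [apply: IN; lra | rewrite /frac_part E1; lra].
left; have E1 : Int_part t = 0%Z by apply: IP; lra.
by split=> //; [apply: IN; lra | rewrite /frac_part E1; lra].
Qed.

(** On an edge, parameter 0 collapses to the range, parameter 1 to the source, and interior
    parameters stay put; none of this moves the point of the interval. *)
Lemma cell1_spec x t : 0 <= t <= INR (deg1 x) ->
  [/\ (Z.to_nat (Int_part t) <= Z.to_nat (- Int_part (- t)) <= deg1 x)%nat,
      reduced1 (cell1 x t) (frac_part t) & pos1 (cell1 x t) (frac_part t) = pos1 x t].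
Proof.
move=> H; rewrite /cell1.
have H1 : 0 <= t <= 1 by move: H; case: x => [s||s] /=; lra.
have x0 : t <> 0 -> exists s, x = Edge s.
  by move: H; case: x => [s||s] /= H t0; [lra | lra | exists s].
case: (unit_floor_ceil H1) => [|[]] [Ht -> -> ->].
- by rewrite Ht; case: (x) => [s||s] /=; split=> //; lra.
- by have [|s ->] := x0; [lra | rewrite Ht /=; split=> //; lra].
- by have [|s ->] := x0; [lra | rewrite /=; split].
Qed.

(** The five open cells occupy the disjoint pieces -1, (-1,0), 0, (0,1), 1 of the interval, and
    [pos1] is injective on each. *)
Lemma pos1_inj x t y u : reduced1 x t -> reduced1 y u -> pos1 x t = pos1 y u ->
  x = y /\ t = u.
Proof.
by case: x => [[]||[]] /=; case: y => [[]||[]] /= => *; split=> //; lra.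
Qed.

Lemma pos1_le x t : 0 <= t <= INR (deg1 x) -> Rabs (pos1 x t) <= 1.
Proof.
by case: x => [[]||[]] /= H; rewrite /Rabs; case: Rcase_abs; lra.
Qed.

Lemma pos1_lt x t : ~~ bd1 x -> reduced1 x t -> Rabs (pos1 x t) < 1.
Proof.
by case: x => [[]||[]] //= _ H; rewrite /Rabs; case: Rcase_abs; lra.
Qed.

(** * Placing the realisation on the double cone *)

Section Place.
Variable k : nat.
Notation mor := (doubled k bd1).

Definition place (l : mor) (t : 'I_k -> R) (j : 'I_k.+1) : R :=
  if unlift ord0 j is Some i then pos1 (crd l i) (t i)
  else sgn (sheet l) * (1 - maxabs (fun i => pos1 (crd l i) (t i))).

Lemma place_lift l t i : place l t (lift ord0 i) = pos1 (crd l i) (t i).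
Proof. by rewrite /place liftK. Qed.

Lemma place0 l t :
  place l t ord0 = sgn (sheet l) * (1 - maxabs (fun i => pos1 (crd l i) (t i))).
Proof. by rewrite /place unlift_none. Qed.

Lemma Rabs_sgn s a : Rabs (sgn s * a) = Rabs a.
Proof. by rewrite Rabs_mult; case: s; rewrite /= ?Rabs_Ropp ?Rabs_R1; lra. Qed.

Lemma gauge_place (l : mor) (t : 'I_k -> R) :
  (forall i, 0 <= t i <= INR (ddeg l i)) -> gauge (place l t) = 1.
Proof.
move=> Ht; rewrite /gauge place0 Rabs_sgn.
have -> : (fun i : 'I_k => place l t (lift ord0 i)) = (fun i => pos1 (crd l i) (t i)).
  by apply: functional_extensionality => i; rewrite place_lift.
have M1 : maxabs (fun i => pos1 (crd l i) (t i)) <= 1.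
  by apply: maxabs_le => [|i]; [lra | exact: pos1_le].
by rewrite Rabs_pos_eq; lra.
Qed.

(** The coordinates after the first recover each arrow and parameter. Off the boundary the maximum
    is below 1, so coordinate 0 is nonzero and its sign reveals the sheet. *)
Lemma place_inj (l l' : mor) (t t' : 'I_k -> R) :
  (forall i, reduced1 (crd l i) (t i)) -> (forall i, reduced1 (crd l' i) (t' i)) ->
  (forall j, place l t j = place l' t' j) -> l = l' /\ forall i, t i = t' i.
Proof.
move=> Rl Rl' E.
have H i : crd l i = crd l' i /\ t i = t' i.
  by apply: pos1_inj => //; rewrite -!place_lift.
split=> [|i]; last by case: (H i).
apply: doubled_eq => [i|nl]; first by case: (H i).
have := E ord0; rewrite !place0.
have -> : (fun i => pos1 (crd l' i) (t' i)) = (fun i => pos1 (crd l i) (t i)).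
  by apply: functional_extensionality => i; case: (H i) => -> ->.
have : maxabs (fun i => pos1 (crd l i) (t i)) < 1.
  by apply: maxabs_lt => [|i]; [lra | exact: pos1_lt].
by case: (sheet l); case: (sheet l') => //=; lra.
Qed.

Definition cell_at (l : mor) (t : 'I_k -> R) : mor :=
  dhead (dtail l (floor_vec t)) (fun i => ceil_vec t i - floor_vec t i)%nat.

Lemma crd_cell_at l t i : crd (cell_at l t) i = cell1 (crd l i) (t i).
Proof. by rewrite !crd_glue. Qed.

Lemma place_cell_at (l : mor) (t : 'I_k -> R) j :
  (forall i, 0 <= t i <= INR (ddeg l i)) ->
  place (cell_at l t) (fun i => frac_part (t i)) j = place l t j.
Proof.
move=> Ht; have H i := cell1_spec (Ht i).
have E i : pos1 (crd (cell_at l t) i) (frac_part (t i)) = pos1 (crd l i) (t i).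
  by rewrite crd_cell_at; case: (H i).
case: (unliftP ord0 j) => [i|] ->; first by rewrite !place_lift.
rewrite !place0.
have -> : (fun i => pos1 (crd (cell_at l t) i) (frac_part (t i))) =
    (fun i => pos1 (crd l i) (t i)) by exact: functional_extensionality.
(* If the reduced cell is in the boundary, the maximum is 1 and coordinate 0 vanishes on either
   sheet; otherwise the sheet of [l] must survive both cuts. *)
case: (boolP [exists i, bd1 (crd (cell_at l t) i)]) => [/existsP[i bi]|].
  suff -> : maxabs (fun i => pos1 (crd l i) (t i)) = 1 by lra.
  apply: Rle_antisym; first by apply: maxabs_le => [|j']; [lra | exact: pos1_le].
  have := le_maxabs (fun i => pos1 (crd l i) (t i)) i; rewrite /= -E.
  by case: (crd _ i) bi => //= s _; rewrite -[sgn s]Rmult_1_r Rabs_sgn Rabs_R1.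
rewrite negb_exists => /forallP nb.
suff -> : sheet (cell_at l t) = sheet l by [].
have nc i : ~~ bd1 (cell1 (crd l i) (t i)) by rewrite -crd_cell_at.
rewrite /cell_at sheet_glue => [|i]; last by have := nc i; rewrite !crd_glue.
(* The intermediate tail is off the boundary too, because every head of a [Bd] vertex is that
   vertex. *)
rewrite sheet_glue // => i; have := nc i; rewrite /cell1 /floor_vec.
by case: (tail1 _ _); case: (_ - _)%nat.
Qed.

Lemma segment_cell_at (l : mor) (t : 'I_k -> R) :
  (forall i, 0 <= t i <= INR (ddeg l i)) ->
  segment (L := doubled_cube k) l (floor_vec t) (ceil_vec t) (cell_at l t).
Proof.
move=> Ht; have H i : (floor_vec t i <= ceil_vec t i <= ddeg l i)%nat.
  by case: (cell1_spec (Ht i)).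
have [|Da Dbc Eabc El] := @head_tail _ l (floor_vec t).
  by move=> i; have /andP[] := H i; exact: leq_trans.
have [|Db Dc Ebc Ebc'] := @head_tail _ (dtail l (floor_vec t))
    (fun i => ceil_vec t i - floor_vec t i)%nat.
  by move=> i; rewrite Dbc; have /andP[_] := H i; exact: leq_sub2r.
exists (dhead l (floor_vec t)).
exists (dtail (dtail l (floor_vec t)) (fun i => ceil_vec t i - floor_vec t i)%nat).
have [_ [_ [_ [Crng _]]]] := doubled_cube_category k.
split; last by split=> //; split=> //; split=> //=; rewrite Ebc'.
rewrite /= Eabc -[in LHS]Ebc'; exact: Crng.
Qed.

(* Both sides say that the two points have the same open cell and the same
   fractional parts: these determine, and are determined by, [place]. *)
Lemma rrel_place (p q : rpoint (doubled_cube k)) : rrel p q <->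
  forall j, place (projT1 p) (proj1_sig (projT2 p)) j =
            place (projT1 q) (proj1_sig (projT2 q)) j.
Proof.
case: p q => [l [t Ht]] [l' [t' Ht']]; rewrite /rrel /=.
have reduced_cell m u : (forall i, 0 <= u i <= INR (ddeg m i)) ->
    forall i, reduced1 (crd (cell_at m u) i) (frac_part (u i)).
  by move=> Hu i; rewrite crd_cell_at; case: (cell1_spec (Hu i)).
have U := segment_unique (doubled_cube_kgraph k).
have S := segment_cell_at Ht; have S' := segment_cell_at Ht'; split.
- move=> [[b [/U/(_ S) Eb /U/(_ S') Eb']] Ef] j.
  rewrite -(place_cell_at j Ht) -(place_cell_at j Ht') -Eb -Eb'.
  by congr (place b _ j); exact: functional_extensionality.
- move=> E; have [|Ec Ef] := place_inj (reduced_cell _ _ Ht) (reduced_cell _ _ Ht').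
    by move=> j; rewrite !place_cell_at.
  by split=> //; exists (cell_at l t); split=> //; rewrite Ec.
Qed.

Definition level : Type := {x : 'I_k.+1 -> R | gauge x = 1}.

Definition to_level (p : rpoint (doubled_cube k)) : level :=
  exist _ (place (projT1 p) (proj1_sig (projT2 p)))
    (gauge_place (proj2_sig (projT2 p))).

(** * The inverse map, orthant by orthant *)

Definition neg (a : R) : bool := if Rle_lt_dec 0 a then false else true.

Lemma sgn_neg a : sgn (neg a) * Rabs a = a.
Proof.
by rewrite /neg; case: Rle_lt_dec => H /=; [rewrite Rabs_pos_eq | rewrite Rabs_left]; lra.
Qed.

Lemma sgn_neg_ge0 a : 0 <= sgn (neg a) * a.
Proof. by rewrite /neg; case: Rle_lt_dec => H /=; lra. Qed.

(** The cells of degree (1,...,1): [place] sends the closed cube of [full d] to the part of the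
    double cone in the closed orthant with signs [d]. *)
Definition full (d : 'I_k.+1 -> bool) : mor :=
  glue _ (fun i => Edge (d (lift ord0 i))) (d ord0).

(** The solution [t] of [sgn s * (1 - t) = y] when [y] has the sign [sgn s]. *)
Definition height (x : 'I_k.+1 -> R) (i : 'I_k) : R := 1 - Rabs (x (lift ord0 i)).

Lemma height_cube d (x : level) i :
  0 <= height (proj1_sig x) i <= INR (ddeg (full d) i).
Proof.
case: x => x gx; rewrite /height /ddeg crd_glue /=.
have := le_maxabs (fun i : 'I_k => x (lift ord0 i)) i; have := Rabs_pos (x (lift ord0 i)).
by have := Rabs_pos (x ord0); move: gx; rewrite /gauge /=; lra.
Qed.

Definition full_point d (x : level) : rpoint (doubled_cube k) :=
  existT _ (full d : Mor (doubled_cube k)) (exist _ (height (proj1_sig x)) (height_cube d x)).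

(** With matching signs, [height] inverts [pos1], and [gauge x = 1] recovers coordinate 0. A
    vanishing coordinate fits both signs, so a point on a wall is represented in every adjacent
    cell. *)
Lemma to_level_full_point d (x : level) :
  (forall j, 0 <= sgn (d j) * proj1_sig x j) -> to_level (full_point d x) = x.
Proof.
case: x => x gx Hd; apply: sub_eq => /= j.
have E j' : sgn (d j') * Rabs (x j') = x j'.
  rewrite -(Rabs_sgn (d j')) Rabs_pos_eq; last exact: (Hd j').
  by case: (d j') => /=; lra.
have El : (fun i => pos1 (crd (full d) i) (height x i)) = (fun i : 'I_k => x (lift ord0 i)).
  apply: functional_extensionality => i; rewrite crd_glue /= -[RHS]E /height; lra.
case: (unliftP ord0 j) => [i|] ->.
  by rewrite place_lift; exact: (congr1 (fun h => h i) El).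
rewrite place0 El sheet_glue // -[RHS]E; have := gx; rewrite /gauge => gx1.
by congr (_ * _); lra.
Qed.

Definition of_level (x : level) : rpoint (doubled_cube k) :=
  full_point (fun j => neg (proj1_sig x j)) x.

Lemma of_levelK x : to_level (of_level x) = x.
Proof. by apply: to_level_full_point => j; exact: sgn_neg_ge0. Qed.

Lemma pos1_continuous a (i : 'I_k) (t : vec k) :
  continuous (fun u : vec k => pos1 a (u i) : R_UniformSpace) t.
Proof.
case: a => [s||s] /=; try exact: continuous_const.
apply: (@continuous_mult _ R_AbsRing); first exact: continuous_const.
apply: (@continuous_minus _ R_AbsRing R_NormedModule); first exact: continuous_const.
exact: continuous_coord.
Qed.

Lemma place_continuous l (t : vec k) :
  continuous (fun u : vec k => place l u : vec k.+1) t.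
Proof.
apply: continuous_vec => j; rewrite /place.
case: (unlift ord0 j) => [i|]; first exact: pos1_continuous.
apply: (@continuous_mult _ R_AbsRing); first exact: continuous_const.
apply: (@continuous_minus _ R_AbsRing R_NormedModule); first exact: continuous_const.
apply: (continuous_comp (fun u : vec k => (fun i => pos1 (crd l i) (u i)) : vec k)
  (fun z => maxabs z)); last exact: maxabs_continuous.
by apply: continuous_vec => i; exact: pos1_continuous.
Qed.

Lemma to_level_continuous :
  Defs.continuous (@open_rpoint k (doubled_cube k))
    (@sub_open k.+1 (fun x => gauge x = 1)) to_level.
Proof.
move=> V [U [/open_Rn_locally oU VU]] l; exists (fun t : vec k => U (place l t)); split.
  apply/open_Rn_locally => t Ut; exact: (place_continuous (oU _ Ut)).
by move=> t; rewrite VU.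
Qed.

Lemma height_continuous (x : vec k.+1) :
  continuous (fun y : vec k.+1 => height y : vec k) x.
Proof.
apply: continuous_vec => i.
have c : continuous (fun y : vec k.+1 => Rabs (y (lift ord0 i)) : R_UniformSpace) x.
  by apply: continuous_Rabs_fun; exact: continuous_coord.
apply: (@continuous_minus _ R_AbsRing R_NormedModule) c; exact: continuous_const.
Qed.

(* The closed orthants form a finite closed cover, and on each of them the
   inverse is given by the single continuous formula [height]. *)
Lemma of_level_open (O : rpoint (doubled_cube k) -> Prop) :
  (forall p q, to_level p = to_level q -> O p -> O q) -> open_rpoint O ->
  @sub_open k.+1 (fun x => gauge x = 1) (fun x => O (of_level x)).
Proof.
move=> satO oO.
have Uex l := constructive_indefinite_description _ (oO l).
pose U l := proj1_sig (Uex l); have HU l := proj2_sig (Uex l).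
(* Each closed orthant containing [x] imposes its own condition; on walls these agree because [O] is
   saturated. Finite functions [d] make this a finite intersection of neighbourhoods. *)
exists (fun x => forall d : {ffun 'I_k.+1 -> bool},
  (forall j, 0 <= sgn (d j) * x j) -> U (full d) (height x)); split.
  apply/open_Rn_locally => x Ux; apply: locally_all => d.
  case: (excluded_middle_informative (forall j, 0 <= sgn (d j) * x j)) => [xd|nxd].
    have [/open_Rn_locally oU _] := HU (full d).
    apply: (filter_imp (fun y => U (full d) (height y))) => [y Uy _|] //.
    exact: (height_continuous (oU _ (Ux d xd))).
  (* A closed orthant that misses [x] also misses a neighbourhood of it, so its condition is vacuous
     there. *)
  have [j xj] : exists j, sgn (d j) * x j < 0.
    case: (excluded_middle_informative (exists j, sgn (d j) * x j < 0)) => // H.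
    by case: nxd => j; apply: Rnot_lt_le => xj; apply: H; exists j.
  have cj : continuous (fun y : vec k.+1 => sgn (d j) * y j : R_UniformSpace) x.
    apply: (@continuous_mult _ R_AbsRing); first exact: continuous_const.
    exact: continuous_coord.
  apply: (filter_imp (fun y => sgn (d j) * y j < 0)).
    by move=> y yj yd; case: (Rlt_not_le _ _ yj (yd j)).
  exact: (cj _ (open_lt 0 _ xj)).
move=> x; split=> [Ox d xd|Ux].
  have [_ HO] := HU (full d).
  apply: (proj1 (HO (exist _ _ (height_cube d x)))); apply: (satO _ (full_point d x)) Ox.
  by rewrite of_levelK (to_level_full_point xd).
have := Ux [ffun j => neg (proj1_sig x j)].
have [_ HO] := HU (full (fun j => neg (proj1_sig x j))).
have -> : full [ffun j => neg (proj1_sig x j)] = full (fun j => neg (proj1_sig x j)).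
  by apply: congr1; apply: functional_extensionality => j; rewrite ffunE.
move=> H; apply: (proj2 (HO (exist _ _ (height_cube _ x)))); apply: H => j.
by rewrite ffunE; exact: sgn_neg_ge0.
Qed.

End Place.

Theorem theorem5p1 : forall k : nat,
  exists L : kgraph_data k,
    is_kgraph L /\ finite_kgraph L /\
    homeomorphic (@open_realisation k L) (@open_sphere k).
Proof.
move=> k; exists (doubled_cube k); split; first exact: doubled_cube_kgraph.
split; first exact: doubled_cube_finite.
apply: homeomorphic_trans (gauge_sphere_homeomorphic k).
apply: quot_homeomorphic (@to_level_continuous k) (@of_level_open k).
  move=> p q; rewrite rrel_place; split=> [E|E j]; first by apply: sub_eq.
  by have := congr1 (fun x => proj1_sig x j) E.
exact: of_levelK.
Qed.
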